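(* In the layered network described in the context, assume $k_i\ge 2$ for all $i=1,\dots,l$. Then the VC-dimension of the class $\Phi=\{\phi(w,\cdot):w\in\mathbb{R}^k\}$ of $\{0,1\}$-valued functions on $\mathbb{R}^N$ satisfies $$\mathrm{VCdim}(\Phi)\;\le\;2k\big(\log_2(4ed)-H(\mathbf v|\mathbf u)\big).$$
   Context: Network architecture: fix integers $N\ge 1$, $l\ge 1$, layer widths $q_0:=N$, $q_1,\dots,q_{l-1}\ge 1$, $q_l:=1$, block sizes $k_1,\dots,k_l\ge 1$ with $k:=\sum_i k_i$, and positive integers $\alpha_1,\dots,\alpha_l$, $\beta_1,\dots,\beta_l$. The weight vector is $w=(w_1,\dots,w_l)\in\mathbb{R}^k$ with $w_i\in\mathbb{R}^{k_i}$. For each $i$ and $j\in\{1,\dots,q_i\}$, $\tau_{i,j}:\mathbb{R}^{k_i}\times\mathbb{R}^{q_{i-1}}\to\mathbb{R}$ is a real polynomial of total degree at most $\alpha_i$ in the coordinates of $w_i$ and of total degree at most $\beta_i$ in the remaining $q_{i-1}$ variables. For an input $x\in\mathbb{R}^N$ set $y_0:=x$ and recursively $y_{i,j}(w,x):=\tau_{i,j}(w_i,y_{i-1,1}(w,x),\dots,y_{i-1,q_{i-1}}(w,x))$; the network output is $y_l(w,x):=y_{l,1}(w,x)$, and the network computes $\phi(w,x)=1$ if $y_l(w,x)\ge 0$ and $\phi(w,x)=0$ otherwise. Define $d_l:=\alpha_l$, $d_i:=\alpha_i\prod_{j=i+1}^l\beta_j$ for $i<l$, $d:=\sum_{i=1}^l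 d_i$, probability vectors $\mathbf v:=(k_1/k,\dots,k_l/k)$, $\mathbf u:=(d_1/d,\dots,d_l/d)$, and $H(\mathbf v|\mathbf u):=\sum_{i=1}^l v_i\log_2(v_i/u_i)$. A finite set $S\subseteq\mathbb{R}^N$ is shattered by $\Phi$ if every function $S\to\{0,1\}$ is the restriction of some member of $\Phi$; $\mathrm{VCdim}(\Phi)$ is the largest cardinality of a shattered set. Here $e$ is Euler's number. *)

(* Defs.v *)
From Stdlib Require Import Reals.
From mathcomp Require Import all_boot all_algebra.
From mathcomp Require Import Rstruct.
From mathcomp Require Import mpoly.

Set Implicit Arguments.
Unset Strict Implicit.
Unset Printing Implicit Defensive.

Import GRing.Theory.

(* A real polynomial in n = a + b variables (the first a variables being the
   weights w_i, the last b variables being the outputs of the previous layer)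
   has total degree at most da in the first group and at most db in the
   second group: every monomial in its support satisfies both bounds. *)
Definition split_degree_le (a b : nat) (p : mpoly.mpoly (a + b) R)
    (da db : nat) : Prop :=
  forall m : mpoly.multinom (a + b), m \in mpoly.msupp p ->
    (\sum_(j < a) m (lshift b j) <= da)%N /\
    (\sum_(j < b) m (rshift a j) <= db)%N.

(* Network data:
   - q : nat -> nat  layer widths (q 0 = N, q l = 1),
   - k : nat -> nat  block sizes k_i (used for i = 1..l),
   - tau i j : polynomial in k i + q (i-1) variables (used for 1 <= i <= l,
     j < q i),
   - w i : 'I_(k i) -> R  the weight block w_i.
   Layer outputs y i : nat -> R (the j-th coordinate for j < q i; junk value 0
   outside the range, never used). *)
Fixpoint layer (q k : nat -> nat)
    (tau : forall i j : nat, mpoly.mpoly (k i + q i.-1) R)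
    (w : forall i : nat, 'I_(k i) -> R) (N : nat) (x : 'rV[R]_N)
    (i : nat) : nat -> R :=
  match i with
  | 0 => fun j => match insub j with Some o => x 0%R o | None => 0%R end
  | i'.+1 => fun j =>
      mpoly.meval
        (fun v : 'I_(k i'.+1 + q i') =>
           match split v with
           | inl a => w i'.+1 a
           | inr b => layer tau w x i' (nat_of_ord b)
           end)
        (tau i'.+1 j)
  end.

(* Network output y_l(w, x) = y_{l,1}(w,x) (index 0 in 0-based numbering). *)
Definition net_output (q k : nat -> nat)
    (tau : forall i j : nat, mpoly.mpoly (k i + q i.-1) R)
    (w : forall i : nat, 'I_(k i) -> R) N (x : 'rV[R]_N) (l : nat) : R :=
  layer (q := q) (k := k) tau w x l 0.

Definition net_phi (q k : nat -> nat)
    (tau : forall i j : nat, mpoly.mpoly (k i + q i.-1) R)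
    (w : forall i : nat, 'I_(k i) -> R) N (x : 'rV[R]_N) (l : nat) : bool :=
  (0 <= net_output tau w x l)%R.

Definition shattered (q k : nat -> nat)
    (tau : forall i j : nat, mpoly.mpoly (k i + q i.-1) R) N (l : nat) (S : seq 'rV[R]_N) : Prop :=
  forall f : 'rV[R]_N -> bool,
    exists w : forall i : nat, 'I_(k i) -> R,
      forall x, x \in S -> net_phi (q := q) tau w x l = f x.

Local Open Scope R_scope.

Definition log2 (x : R) : R := ln x / ln 2.

Definition ksum (k : nat -> nat) (l : nat) : nat := (\sum_(1 <= i < l.+1) k i)%N.

Definition dlayer (alpha beta : nat -> nat) (l i : nat) : nat :=
  (alpha i * \prod_(i.+1 <= j < l.+1) beta j)%N.

Definition dsum (alpha beta : nat -> nat) (l : nat) : nat :=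
  (\sum_(1 <= i < l.+1) dlayer alpha beta l i)%N.

Definition rel_entropy (k alpha beta : nat -> nat) (l : nat) : R :=
  \big[Rplus/0]_(1 <= i < l.+1)
    (let vi := INR (k i) / INR (ksum k l) in
     let ui := INR (dlayer alpha beta l i) / INR (dsum alpha beta l) in
     vi * log2 (vi / ui)).

(* Main.v *)
Require Import Defs.
From Stdlib Require Import Reals Lra.
From mathcomp Require Import all_boot all_algebra.
From mathcomp Require Import Rstruct.
From mathcomp Require Import mpoly.
From mathcomp Require Import order polyrcf ring lra zify.
From mathcomp Require boolp.

(* Let [f_1, ..., f_m] be the network outputs at the shattered points, seen as
   polynomials in the weights; after a small shift all [2 ^ m] strict sign
   patterns occur.  Add the [2 k] linear polynomials bounding a large box, so
   that there are [M = m + 2 k] polynomials and every sign cell is bounded.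
   Maximising [prod_j |f_j| ^ s_j * exp (- <c, w>)] over a cell yields a point
   of the cell where [sum_j s_j d_a f_j / f_j = c_a] for all [a].  Hence, with
   unknowns [w] and [u_j = s_j / f_j], each value [(s, c)] of the polynomial map
   [(u_j f_j, sum_j u_j d_a f_j)] has at least [2 ^ m] preimages, while its
   components have degree 1 in [u] and degree [d_i] in the [i]-th weight block.
   If [L] is a linear form separating the preimages, the products of
   [L ^ i], [i < 2 ^ m], with the monomials of degree at most [r] in the
   components are linearly independent; comparing with the number of monomials
   and letting [r] tend to infinity gives the multihomogeneous Bezout bound
   [2 ^ m <= (M + k)! / (M! prod_i k_i!) * prod_i d_i ^ k_i].  Finally
   [k_i! >= (k_i / e) ^ k_i] and [ln ((t + 3) / 4) <= t / 4] at [t = m / k]. *)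

Set Implicit Arguments.
Unset Strict Implicit.
Unset Printing Implicit Defensive.

Import Order.TTheory GRing.Theory Num.Theory.

Local Open Scope ring_scope.

(** * The multihomogeneous Bezout inequality *)

(** Comparison of leading coefficients as [r] tends to infinity, made effective. The inequality
    [key] is Bernoulli's, that is, [(r / (r + C)) ^ n >= 1 - n * C / (r + C)] with denominators
    cleared. *)
Lemma leq_of_leq_mul_exp (a b C n : nat) :
  (forall r, (a * r ^ n <= b * (r + C) ^ n)%N) -> (a <= b)%N.
Proof.
move=> H; rewrite leqNgt; apply/negP => ltba.
have key r : ((r + C) ^ n * (r + C) <= r ^ n * (r + C) + n * C * (r + C) ^ n)%N.
  elim: {H} n => [|n IH]; first by rewrite !expn0; lia.
  rewrite !expnS.
  have h1 : (r ^ n <= (r + C) ^ n)%N.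
    case: n {IH} => // n; rewrite leq_exp2r //; lia.
  nia.
(* With this [r] the Bernoulli error term [a * n * C] is exactly [r]. So [h7] reads
   [a * (r + C) <= b * (r + C) + r], which excludes [a >= b + 1] as soon as [C > 0]. *)
pose r := (a * n * C)%N.
have h1 := H r; have h2 := key r.
have h3 : (0 < (r + C) ^ n)%N \/ (r + C = 0)%N.
  by case: (posnP (r + C)) => [->|h]; [right | left; rewrite expn_gt0 h].
case: h3 => [h3|h3]; last first.
  have h4 : (C = 0)%N by lia.
  by have := H 1%N; rewrite h4 addn0 exp1n; lia.
have h5 : (a * ((r + C) ^ n * (r + C)) <= a * (r ^ n * (r + C) + n * C * (r + C) ^ n))%N.
  by rewrite leq_mul2l h2 orbT.
have h6 : (a * r ^ n * (r + C) <= b * (r + C) ^ n * (r + C))%N.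
  by rewrite leq_mul2r h1 orbT.
have h7 : (a * (r + C) <= b * (r + C) + r)%N.
  rewrite -(leq_pmul2r h3) /r; rewrite /r in h5 h6; nia.
case: (posnP C) => [C0|Cgt]; last by nia.
have := H 1%N; rewrite C0 addn0 exp1n; lia.
Qed.

Lemma expn_le_ffact (r n : nat) : (r ^ n <= (r + n) ^_ n)%N.
Proof.
elim: n => [|n IH]; first by rewrite expn0 ffactn0.
by rewrite addnS ffactnS /= expnS leq_mul //; lia.
Qed.

Lemma ffact_le_expn (r n : nat) : (r ^_ n <= r ^ n)%N.
Proof.
elim: n r => [|n IH] r; first by rewrite expn0 ffactn0.
rewrite ffactnS expnS leq_mul //; apply: leq_trans (IH _) _.
by case: n {IH} => // n; rewrite leq_exp2r // leq_pred.
Qed.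

(** The set has [binomial (r + n) n] elements, and [n!] times this is the falling factorial
    [(r + n) ^_ n]. *)
Lemma card_simplex_ge (r n : nat) :
  (r ^ n <= n`! * #|[set t : n.-tuple 'I_r.+1 | (\sum_(i <- t) i <= r)%N]|)%N.
Proof.
by rewrite card_partial_ord_partitions addnC mulnC bin_ffact expn_le_ffact.
Qed.

Lemma digits_inj (B n : nat) (x y : 'I_n -> nat) :
    (forall v, x v < B)%N -> (forall v, y v < B)%N ->
  (\sum_(v < n) x v * B ^ v = \sum_(v < n) y v * B ^ v)%N -> x =1 y.
Proof.
elim: n x y => [|n IH] x y hx hy; first by move=> _ [].
rewrite !big_ord_recl /= expn0 !muln1.
have shift z : (\sum_(i < n) z (lift ord0 i) * B ^ bump 0 i =
   (\sum_(i < n) z (lift ord0 i) * B ^ i) * B)%N.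
  rewrite big_distrl; apply: eq_bigr => i _.
  by rewrite /bump leq0n add1n expnSr mulnA.
rewrite !shift => e.
(* The lowest digit is the residue modulo [B]; the higher digits then follow by induction. *)
have e0 : x ord0 = y ord0.
  have := congr1 (modn^~ B) e.
  by rewrite /= !(addnC (_ ord0)) !modnMDl !modn_small.
move: e; rewrite e0 => /addnI /eqP; rewrite eqn_pmul2r; last first.
  by apply: leq_ltn_trans (hx ord0).
move/eqP/(IH (fun i => x (lift ord0 i)) (fun i => y (lift ord0 i))) => h v.
case: (unliftP ord0 v) => [j|] -> //; apply: h => j'; [exact: hx|exact: hy].
Qed.

(** * Degrees in blocks of variables *)

Definition block_degree_le (F : nzRingType) (n : nat) (I : Type)
    (blk : 'I_n -> I -> bool) (p : {mpoly F[n]}) (d : I -> nat) : Prop :=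
  forall m, m \in msupp p -> forall i, (\sum_(v < n | blk v i) m v <= d i)%N.

Section BlockDegree.

Variables (F : nzRingType) (n : nat) (I : Type) (blk : 'I_n -> I -> bool).
Local Notation bdeg := (@block_degree_le F n I blk).
Implicit Types (p q : {mpoly F[n]}) (d e : I -> nat).

Lemma block_degree_leW p d e :
  bdeg p d -> (forall i, d i <= e i)%N -> bdeg p e.
Proof. by move=> pd de m mp i; apply: leq_trans (pd m mp i) (de i). Qed.

Lemma block_degree0 d : bdeg 0 d.
Proof. by move=> m; rewrite -mpolyC0 msupp0. Qed.

Lemma block_degreeC c d : bdeg c%:MP d.
Proof.
move=> m; rewrite msuppC; case: ifP => // _; rewrite inE => /eqP -> i.
by rewrite big1 // => v _; rewrite mnm0E.
Qed.

Lemma block_degreeXU u d : (forall i, blk u i -> 0 < d i)%N -> bdeg 'X_u d.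
Proof.
move=> hd m; rewrite msuppX inE => /eqP -> i.
have [ui|ui] := boolP (blk u i).
  rewrite (bigD1 u) //= mnm1E eqxx big1 ?addn0 ?hd // => v /andP[_ /negPf vu].
  by rewrite mnm1E eq_sym vu.
rewrite big1 // => v vi; rewrite mnm1E; case: eqP => // uv.
by rewrite uv vi in ui.
Qed.

Lemma block_degreeD p q d : bdeg p d -> bdeg q d -> bdeg (p + q) d.
Proof.
by move=> hp hq m /msuppD_le; rewrite mem_cat => /orP[/hp|/hq].
Qed.

Lemma block_degreeN p d : bdeg p d -> bdeg (- p) d.
Proof. by move=> hp m; rewrite (perm_mem (msuppN p)) => /hp. Qed.

Lemma block_degreeZ c p d : bdeg p d -> bdeg (c *: p) d.
Proof. by move=> hp m /msuppZ_le /hp. Qed.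

Lemma block_degree_sum (J : Type) (r : seq J) (P : pred J) (p : J -> {mpoly F[n]}) d :
  (forall j, P j -> bdeg (p j) d) -> bdeg (\sum_(j <- r | P j) p j) d.
Proof.
move=> hp; apply: (big_ind (fun q => bdeg q d)) => //.
- exact: block_degree0.
- by move=> *; apply: block_degreeD.
Qed.

Lemma block_degreeM p q d e :
  bdeg p d -> bdeg q e -> bdeg (p * q) (fun i => d i + e i)%N.
Proof.
move=> hp hq m /msuppM_le /allpairsP [[m1 m2] /= [/hp h1 /hq h2 ->]] i.
rewrite (eq_bigr (fun v => m1 v + m2 v)%N) => [|v _]; last by rewrite mnmDE.
by rewrite big_split leq_add.
Qed.

Lemma block_degreeX p d j :
  bdeg p d -> bdeg (p ^+ j) (fun i => j * d i)%N.
Proof.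
move=> hp; elim: j => [|j IH]; first by rewrite expr0; apply: block_degreeC.
rewrite exprS; apply: block_degree_leW (block_degreeM hp IH) _ => i.
by rewrite mulSn.
Qed.

Lemma block_degree_prodX (J : Type) (r : seq J) (p : J -> {mpoly F[n]})
    (b : J -> nat) (e : J -> I -> nat) :
    (forall j, bdeg (p j) (e j)) ->
  bdeg (\prod_(j <- r) p j ^+ b j) (fun i => \sum_(j <- r) b j * e j i)%N.
Proof.
move=> hp; elim: r => [|j r IH]; first by rewrite big_nil; apply: block_degreeC.
rewrite big_cons; apply: block_degree_leW (block_degreeM (block_degreeX (hp j)) IH) _.
by move=> i; rewrite big_cons.
Qed.

(** A monomial of [p] becomes a product of powers of the [h v], so its degree in block [i] is its
    weighted degree, where the variable [v] has weight [e v i]. *)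
Lemma block_degree_subst (n' : nat) (p : {mpoly F[n']}) (h : 'I_n' -> {mpoly F[n]})
    (e : 'I_n' -> I -> nat) d :
    (forall v, bdeg (h v) (e v)) ->
    (forall m, m \in msupp p -> forall i, \sum_v m v * e v i <= d i)%N ->
  bdeg (mmap (@mpolyC n F) h p) d.
Proof.
move=> he hp; rewrite /mmap big_seq; apply: block_degree_sum => m mp.
have hC : bdeg (p@_m)%:MP (fun=> 0%N) by apply: block_degreeC.
have hP : bdeg (mmap1 h m) (fun i => \sum_v m v * e v i)%N.
  exact: block_degree_prodX.
exact: block_degree_leW (block_degreeM hC hP) (hp m mp).
Qed.

Lemma block_degree_mderiv a p d : bdeg p d -> bdeg p^`M(a) d.
Proof.
move=> hp m; rewrite mcoeff_msupp mcoeff_mderiv => h i.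
have /hp/(_ i) : (m + U_(a))%MM \in msupp p.
  by rewrite mcoeff_msupp; apply: contraNneq h => ->; rewrite mul0rn.
by apply: leq_trans; apply: leq_sum => v _; rewrite mnmDE leq_addr.
Qed.

End BlockDegree.

(** * Linear dependence and counting of monomials *)

(** The matrix of coefficients has more rows than columns, hence a nonzero left kernel vector. *)
Lemma mpoly_lin_dep (F : fieldType) (n : nat) (C S : finType)
    (p : C -> {mpoly F[n]}) (mon : S -> 'X_{1..n}) :
    (forall c m, m \in msupp (p c) -> exists s, m = mon s) ->
    (#|S| < #|C|)%N ->
  exists v : C -> F, (exists c, v c != 0) /\ \sum_c v c *: p c = 0.
Proof.
move=> hp ltSC.
pose A := \matrix_(i < #|C|, j < #|S|) (p (enum_val i))@_(mon (enum_val j)).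
have kA : kermx A != 0.
  rewrite -mxrank_eq0 mxrank_ker subn_eq0 -ltnNge.
  exact: leq_ltn_trans (rank_leq_col A) ltSC.
have /rowV0Pn [v vA vn0] := kA.
have /sub_kermxP vA0 := vA.
exists (fun c => v 0 (enum_rank c)); split.
  have /rV0Pn [j vj] := vn0.
  by exists (enum_val j); rewrite enum_valK.
apply/mpolyP => m; rewrite raddf_sum /= mcoeff0.
rewrite (eq_bigr (fun c => v 0 (enum_rank c) * (p c)@_m)) => [|c _]; last first.
  by rewrite mcoeffZ.
have [/existsP [s /eqP ms]|nos] := boolP [exists s, m == mon s].
  have := congr1 (fun M : 'rV_#|S| => M 0 (enum_rank s)) vA0.
  rewrite [RHS]mxE; apply: etrans; rewrite mxE.
  rewrite (reindex _ (onW_bij _ (enum_val_bij C))) /=.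
  by apply: eq_bigr => i _; rewrite [A _ _]mxE !enum_valK !enum_rankK ms.
apply: big1 => c _; rewrite memN_msupp_eq0 ?mulr0 //.
apply: contraNN nos => /hp [s ->]; by apply/existsP; exists s.
Qed.

(** Restriction to [A] is injective on these vectors, and the tuples of length [#|A|] with sum at
    most [D] number [binomial (D + #|A|) #|A|]. The bound [B] makes the exponent vectors a finite
    type. *)
Lemma card_supported_simplex (n D B : nat) (A : {pred 'I_n}) :
  (#|[pred g : {ffun 'I_n -> 'I_B.+1} | [forall v, (v \notin A) ==> (g v == ord0)]
      && (\sum_(v in A) g v <= D)%N]| * #|A|`! <= (D + #|A|) ^ #|A|)%N.
Proof.
set S := [pred g | _].
pose h (g : {ffun 'I_n -> 'I_B.+1}) : #|A|.-tuple 'I_D.+1 :=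
  [tuple inord (g (enum_val i)) | i < #|A|].
have hle (g : {ffun 'I_n -> 'I_B.+1}) v : g \in S -> v \in A -> (g v < D.+1)%N.
  rewrite inE => /andP[_ gD] vA; rewrite ltnS; apply: leq_trans gD.
  by rewrite (bigD1 v) //= leq_addr.
have hinj : {in S &, injective h}.
  move=> g1 g2 S1 S2 e; apply/ffunP => v; apply/val_inj.
  have [vA|vA] := boolP (v \in A); last first.
    move: S1 S2; rewrite !inE => /andP[/forallP/(_ v)/implyP/(_ vA)/eqP -> _].
    by move=> /andP[/forallP/(_ v)/implyP/(_ vA)/eqP -> _].
  have := congr1 (fun t : #|A|.-tuple _ => val (tnth t (enum_rank_in vA v))) e.
  by rewrite !tnth_mktuple /= !enum_rankK_in // !inordK // ?hle.
rewrite -(card_in_imset hinj).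
apply: (@leq_trans
  (#|[set t : #|A|.-tuple 'I_D.+1 | (\sum_(i <- t) i <= D)%N]| * #|A|`!)).
  rewrite leq_mul2r subset_leq_card ?orbT //.
  apply/subsetP => _ /imsetP [g Sg ->]; rewrite inE big_tuple.
  move: (Sg); rewrite inE => /andP[_]; apply: leq_trans.
  rewrite [leqRHS]big_enum_val /=; apply: leq_sum => i _.
  by rewrite tnth_mktuple inordK // hle // enum_valP.
by rewrite card_partial_ord_partitions bin_ffact addnC ffact_le_expn.
Qed.

Lemma card_block_simplex (n B : nat) (I : finType) (blk : 'I_n -> I) (D : I -> nat) :
  (#|[set c : {ffun 'I_n -> 'I_B.+1} | [forall i, \sum_(v | blk v == i) c v <= D i]]|
    * \prod_i #|[pred v | blk v == i]|`!
   <= \prod_i (D i + #|[pred v | blk v == i]|) ^ #|[pred v | blk v == i]|)%N.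
Proof.
pose S i := [pred g : {ffun 'I_n -> 'I_B.+1} |
  [forall v, (v \notin [pred v | blk v == i]) ==> (g v == ord0)]
      && (\sum_(v in [pred v | blk v == i]) g v <= D i)%N].
apply: (@leq_trans (\prod_i #|S i| * \prod_i #|[pred v | blk v == i]|`!)); last first.
  by rewrite -big_split /=; apply: leq_prod => i _; apply: card_supported_simplex.
rewrite leq_mul2r; apply/orP; right.
(* A vector is cut into its restrictions to the blocks, each extended by zero, so the count is
   bounded by a product over the blocks. *)
pose h (c : {ffun 'I_n -> 'I_B.+1}) : {ffun I -> {ffun 'I_n -> 'I_B.+1}} :=
  [ffun i => [ffun v => if blk v == i then c v else ord0]].
have hinj : injective h.
  move=> c1 c2 e; apply/ffunP => v.
  have := congr1 (fun f : {ffun I -> {ffun 'I_n -> 'I_B.+1}} => f (blk v) v) e.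
  by rewrite !ffunE eqxx.
have -> : (\prod_i #|S i|)%N = #|family S|.
  by rewrite card_family foldrE big_map big_enum.
rewrite -(card_imset _ hinj) subset_leq_card //.
apply/subsetP => g /imsetP [c]; rewrite inE => /forallP hc ->.
apply/familyP => i; rewrite inE; apply/andP; split.
  by apply/forallP => v; apply/implyP => /negPf; rewrite ffunE ffunE inE => ->.
apply: leq_trans (hc i); apply: eq_leq; apply: eq_bigr => v.
by rewrite !ffunE inE => ->.
Qed.

Lemma poly_eq0_of_roots (F : idomainType) (J : finType) (y : J -> F) (p : {poly F}) :
  injective y -> (size p <= #|J|)%N -> (forall j, p.[y j] = 0) -> p = 0.
Proof.
move=> yinj sp hp; apply/eqP; apply/negPn/negP => p0.
have := @max_poly_roots _ p [seq y j | j <- enum J] p0.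
rewrite size_map -cardE map_inj_uniq ?enum_uniq // => /(_ _ isT).
have -> : all (root p) [seq y j | j <- enum J].
  by apply/allP => _ /mapP[j _ ->]; rewrite /root hp.
by move=> /(_ isT); rewrite ltnNge sp.
Qed.

Lemma succ_natr_inj (F : numFieldType) (Q : nat) :
  injective (fun b : 'I_Q => b.+1%:R : F).
Proof. by move=> b1 b2 /eqP; rewrite eqr_nat eqSS => /eqP /val_inj. Qed.

(** The coefficients are taken on the moment curve [(1, t, t ^ 2, ...)]. Each form value is then a
    nonzero polynomial in [t], and the product of these finitely many polynomials has finitely many
    roots. *)
Lemma separating_linear_form (F : numFieldType) (n : nat) (J : finType)
    (x : J -> 'I_n -> F) :
    (forall j, exists v, x j v != 0) ->
  exists a : 'I_n -> F, forall j, \sum_v a v * x j v != 0.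
Proof.
move=> hx.
pose P j : {poly F} := \poly_(i < n) (if insub i is Some v then x j v else 0).
have Pj (v : 'I_n) j : (P j)`_v = x j v by rewrite coef_poly ltn_ord valK.
have Pn0 : \prod_j P j != 0.
  apply/prodf_neq0 => j _; have [v xv] := hx j.
  by apply: contraNneq xv => P0; rewrite -Pj P0 coef0.
(* [Q] exceeds the degree of the product, so the points [1, ..., Q] cannot all be roots. *)
pose Q := size (\prod_j P j).
have [/existsP [t Pt]|nroot] := boolP [exists t : 'I_Q, ~~ root (\prod_j P j) t.+1%:R].
  exists (fun v => t.+1%:R ^+ v) => j.
  have : ~~ root (P j) t.+1%:R.
    apply: contraNN Pt; rewrite /root horner_prod => /eqP h.
    by rewrite (bigD1 j) //= h mul0r.
  rewrite /root horner_poly; congr (_ != _).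
  by apply: eq_bigr => v _; rewrite valK mulrC.
move/eqP: Pn0; case; apply: (poly_eq0_of_roots (@succ_natr_inj F Q)).
  by rewrite card_ord.
by move=> t; move: nroot; rewrite negb_exists => /forallP/(_ t); rewrite negbK => /eqP.
Qed.

Section Bezout.

Variables (F : numFieldType) (n : nat) (I : finType) (blk : 'I_n -> I).
Variables (d : I -> nat) (G : 'I_n -> {mpoly F[n]}) (T : finType).

Let bdeg := @block_degree_le F n I (fun v i => blk v == i).
Let k i := #|[pred v | blk v == i]|.

Hypothesis G_degree : forall v, bdeg (G v) d.
(** Fibers over positive integer vectors suffice: in characteristic zero these points detect the
    vanishing of a polynomial, and positive exponents are what the critical points below provide. *)
Hypothesis G_fibers : forall c : 'I_n -> nat, exists z : T -> 'I_n -> F,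
  (forall t t', t != t' -> exists v, z t v != z t' v) /\
  (forall t v, (G v).@[z t] = (c v).+1%:R).

Let simplex r := {t : n.-tuple 'I_r.+1 | (\sum_(i <- t) i <= r)%N}.
(* Kronecker substitution: giving [G v] the value [x ^ (r.+1 ^ v)] turns the
   monomial of exponent [b] into [x ^ code b]. *)
Let code r (b : simplex r) := (\sum_(v < n) tnth (val b) v * r.+1 ^ v)%N.

Lemma code_inj r : injective (@code r).
Proof.
move=> b1 b2 /digits_inj e; apply/val_inj/eq_from_tnth => v; apply/val_inj.
by apply: e => w; exact: ltn_ord.
Qed.

(** The sums are the values at [1, ..., Q] of a polynomial of degree less than [Q]. Its exponents
    [code s] are distinct, so each [y s] is one of its coefficients. *)
Lemma simplex_coef_eq0 (r Q : nat) (y : simplex r -> F) :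
    (forall b : simplex r, code b < Q)%N ->
    (forall b : 'I_Q, \sum_(s : simplex r) y s * b.+1%:R ^+ code s = 0) ->
  forall s, y s = 0.
Proof.
move=> hQ hy s.
pose p : {poly F} := \sum_(s : simplex r) y s *: 'X^(code s).
have p0 : p = 0.
  apply: (poly_eq0_of_roots (@succ_natr_inj F Q)).
    rewrite card_ord; apply: leq_trans (size_sum _ _ _) _.
    apply/bigmax_leqP => s' _; apply: leq_trans (size_scale_leq _ _) _.
    by rewrite size_polyXn.
  move=> b; rewrite horner_sum -[RHS](hy b).
  by apply: eq_bigr => s' _; rewrite hornerZ hornerXn.
have : p`_(code s) = 0 by rewrite p0 coef0.
rewrite coef_sum (bigD1 s) //= coefZ coefXn eqxx mulr1 big1 ?addr0 // => s' ss'.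
by rewrite coefZ coefXn (inj_eq (@code_inj r)) eq_sym (negPf ss') mulr0.
Qed.

(* The polynomials [L ^+ i * \prod_v G v ^+ b v] with [i < #|T|] and [b] in the
   simplex are linearly independent, because the values of [G] are arbitrary
   and [L] separates the points of each fiber. *)
Lemma bezout_count (r : nat) :
  (#|T| * #|{: simplex r}| * \prod_i (k i)`! <=
     \prod_i (r * d i + #|T| + k i) ^ k i)%N.
Proof.
(* Bound for the degree in block [i] of the products: at most [r] factors [G v] of degree [d i], and
   fewer than [#|T|] factors [L]. *)
pose D i := (r * d i + #|T|)%N.
pose B := (\sum_i D i)%N.
pose PS (c : {ffun 'I_n -> 'I_B.+1}) := [forall i, (\sum_(v | blk v == i) c v <= D i)%N].
pose S := {c | PS c}.
suff h : (#|T| * #|{: simplex r}| <= #|{: S}|)%N.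
  have := card_block_simplex B blk D; apply: leq_trans.
  by rewrite leq_mul2r; apply/orP; right; apply: leq_trans h _; rewrite card_sig cardsE.
rewrite leqNgt; apply/negP => ltST.
pose Q := (\sum_(v < n) r.+1 * r.+1 ^ v).+1.
have hQ (b : simplex r) : (code b < Q)%N.
  rewrite ltnS; apply: leq_sum => v _; rewrite leq_mul2r; apply/orP; right.
  by rewrite ltnW.
(* [G_fibers] adds one, so the predecessor makes [G v] take the value [b.+1 ^ (r.+1 ^ v)] on the
   fiber of index [b]. *)
pose cval (b : nat) (v : 'I_n) := ((b.+1) ^ (r.+1 ^ v)).-1.
have [z hz] : exists z : 'I_Q -> T -> 'I_n -> F, forall b : 'I_Q,
    (forall t t', t != t' -> exists v, z b t v != z b t' v) /\
    (forall t v, (G v).@[z b t] = (cval b v).+1%:R).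
  exact: (fin_all_exists (fun b : 'I_Q => G_fibers (cval b))).
(* Indexing by triples [(b, t, t')] yields a single form [L] that separates the points in all [Q]
   fibers at once. *)
have [a ha] : exists a : 'I_n -> F, forall j : {j : 'I_Q * T * T | j.1.2 != j.2},
    \sum_v a v * (z (val j).1.1 (val j).1.2 v - z (val j).1.1 (val j).2 v) != 0.
  apply: separating_linear_form => -[[[b t] t'] /= tt'].
  have [v zv] := (hz b).1 t t' tt'; exists v; by rewrite subr_eq0.
pose L : {mpoly F[n]} := \sum_v a v *: 'X_v.
have LE (w : 'I_n -> F) : L.@[w] = \sum_v a v * w v.
  by rewrite raddf_sum /=; apply: eq_bigr => v _; rewrite mevalZ mevalXU.
have Linj b : injective (fun t => L.@[z b t]).
  move=> t t' /eqP; rewrite -subr_eq0; case: (eqVneq t t') => // tt'.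
  have /= /negP h := ha (Sub (b, t, t') tt').
  rewrite !LE -sumrB => e; case: h; move: e; congr (_ == _).
  by apply: eq_bigr => v _; rewrite mulrBr.
pose p (c : 'I_(#|T|) * simplex r) : {mpoly F[n]} :=
  L ^+ c.1 * \prod_v G v ^+ tnth (val c.2) v.
pose mon (s : S) : 'X_{1..n} := [multinom (val s v : nat) | v < n].
have pdeg c : bdeg (p c) D.
  have Ldeg : bdeg L (fun=> 1%N).
    apply: block_degree_sum => v _; apply: block_degreeZ.
    by apply: block_degreeXU.
  have Gdeg : bdeg (\prod_v G v ^+ tnth (val c.2) v)
      (fun i => (\sum_v tnth (val c.2) v) * d i)%N.
    have h := @block_degree_prodX _ _ _ _ _ (index_enum 'I_n) G
      (fun v => tnth (val c.2) v) (fun=> d) G_degree.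
    by apply: (block_degree_leW h) => i; rewrite big_distrl.
  apply: (block_degree_leW (block_degreeM (block_degreeX (j := c.1) Ldeg) Gdeg)).
  move=> i; rewrite muln1 addnC; apply: leq_add; last exact: ltnW.
  rewrite leq_mul2r; apply/orP; right.
  by have := valP c.2; rewrite big_tuple.
have [|| x [[c0 xc] xp]] := @mpoly_lin_dep F n _ S p mon.
- move=> c' m mp; have hm := pdeg c' m mp.
  have mB v : (m v < B.+1)%N.
    rewrite ltnS; apply: (@leq_trans (D (blk v))).
      by apply: leq_trans (hm (blk v)); rewrite (bigD1 v) //= leq_addr.
    by rewrite /B (bigD1 (blk v)) //= leq_addr.
  pose c1 : {ffun 'I_n -> 'I_B.+1} := [ffun v => inord (m v)].
  have hS : PS c1.
    apply/forallP => i; apply: leq_trans (hm i); apply: eq_leq.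
    by apply: eq_bigr => v _; rewrite ffunE inordK.
  exists (exist PS c1 hS); apply/mnmP => v; rewrite mnmE /= ffunE inordK //.
- by rewrite card_prod card_ord.
(* The dependence relation is evaluated at the points of the fibers, where the monomial in [G]
   indexed by [s] has the value [b.+1 ^ code s]. *)
have {}xp (b : 'I_Q) t :
    \sum_i (\sum_(s : simplex r) x (i, s) * b.+1%:R ^+ code s) * L.@[z b t] ^+ i = 0.
  have := congr1 (meval (z b t)) xp; rewrite meval0 raddf_sum /= => e.
  rewrite -[RHS]e (eq_bigr (fun i => \sum_(s : simplex r)
      x (i, s) * (L.@[z b t] ^+ i * b.+1%:R ^+ code s))) => [|i _]; last first.
    by rewrite big_distrl; apply: eq_bigr => s _ /=; rewrite mulrAC mulrA.
  rewrite pair_big /=; apply: eq_bigr => -[i s] _ /=.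
  rewrite mevalZ mevalM rmorphXn rmorph_prod; congr (_ * (_ * _)).
  rewrite expr_sum; apply: eq_bigr => v _ /=.
  have cS : (cval b v).+1 = (b.+1 ^ (r.+1 ^ v))%N by rewrite prednK // expn_gt0.
  by rewrite rmorphXn /= (hz b).2 cS natrX mulnC exprM.
(* For fixed [b], the relation is a polynomial of size at most [#|T|] that vanishes at the [#|T|]
   distinct values of [L]; hence each coefficient is zero. *)
have xp1 (b : 'I_Q) (i : 'I_(#|T|)) :
    \sum_(s : simplex r) x (i, s) * b.+1%:R ^+ code s = 0.
  pose y i := if insub i is Some i' then
     \sum_(s : simplex r) x (i', s) * b.+1%:R ^+ code s else 0.
  have yE (j : 'I_#|T|) : y j = \sum_(s : simplex r) x (j, s) * b.+1%:R ^+ code s.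
    by rewrite /y valK.
  have : \poly_(i < #|T|) y i = 0.
    apply: (poly_eq0_of_roots (Linj b)); first exact: size_poly.
    move=> t; rewrite horner_poly -[RHS](xp b t).
    by apply: eq_bigr => j _; rewrite yE.
  by move/(congr1 (fun q : {poly F} => q`_i)); rewrite coef_poly ltn_ord coef0 yE.
move: xc; case: c0 => i s.
by rewrite (@simplex_coef_eq0 r Q (fun s => x (i, s)) hQ (xp1^~ i) s) eqxx.
Qed.

Lemma multihomogeneous_bezout : (forall i, 0 < d i)%N ->
  (#|T| * \prod_i (k i)`! <= n`! * \prod_i d i ^ k i)%N.
Proof.
(* The shift [#|T| + n] comes from [r * d i + #|T| + k i <= d i * (r + #|T| + n)], valid since
   [d i >= 1] and [k i <= n]. *)
move=> d_gt0; apply: (@leq_of_leq_mul_exp _ _ (#|T| + n) n) => r.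
have ksum : (\sum_i k i = n)%N.
  rewrite -[RHS]card_ord -sum1_card (partition_big blk predT) //=.
  by apply: eq_bigr => i _; rewrite sum1_card.
apply: (@leq_trans (n`! * (#|T| * #|{: simplex r}| * \prod_i (k i)`!))).
  have := card_simplex_ge r n; rewrite cardsE -card_sig => h.
  rewrite -!mulnA [X in (_ <= X)%N]mulnCA leq_mul2l; apply/orP; right.
  rewrite [(_ * r ^ n)%N]mulnC [X in (_ <= X)%N]mulnA leq_mul2r; apply/orP; right.
  exact: h.
rewrite -!mulnA leq_mul2l; apply/orP; right; rewrite mulnA.
apply: leq_trans (bezout_count r) _.
rewrite -[X in (_ * (_ ^ X))%N]ksum expn_sum -big_split /=; apply: leq_prod => i _.
rewrite -expnMn; have : (k i <= n)%N by rewrite -ksum (bigD1 i) //= leq_addr.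
case: (k i) => // j hj; rewrite leq_exp2r //.
have := d_gt0 i; nia.
Qed.

End Bezout.

(** * Critical points in sign cells *)

Lemma Un_cv_subseq (u : nat -> R) (l : R) (phi : nat -> nat) :
  (forall n, n <= phi n)%N -> Un_cv u l -> Un_cv (fun n => u (phi n)) l.
Proof.
move=> hphi ul eps /ul [N hN]; exists N => n /ssrnat.leP Nn; apply: hN; apply/ssrnat.leP.
exact: leq_trans Nn (hphi n).
Qed.

Lemma Un_cv_const (x : R) : Un_cv (fun=> x) x.
Proof. by move=> eps e0; exists 0%N => n _; rewrite /Rdist Rminus_diag Rabs_R0. Qed.

(** Bolzano-Weierstrass supplies a cluster point, and [phi n] is chosen with [u (phi n)] within
    [1 / (n + 1)] of it. The condition [n <= phi n] plays the part of monotonicity: it sends [phi n]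
    to infinity. *)
Lemma bounded_cv_subseq (u : nat -> R) (rho : R) :
    (forall n, `|u n| <= rho) ->
  exists (phi : nat -> nat) (l : R),
    (forall n, n <= phi n)%N /\ Un_cv (fun n => u (phi n)) l.
Proof.
move=> hu.
have [|l hl] := Bolzano_Weierstrass u _ (compact_P3 (- rho) rho).
  by move=> n; have := hu n; rewrite ler_norml => /andP[/RleP ? /RleP ?].
have pos n : Rlt 0 (/ INR n.+1) by apply/Rinv_0_lt_compat/lt_0_INR/ssrnat.leP.
have /boolp.choice [phi hphi] : forall n, exists p,
    (n <= p)%N /\ Rlt (Rdist (u p) l) (/ INR n.+1).
  move=> n; have [|p [/ssrnat.leP np hp]] := hl (disc l (mkposreal _ (pos n))) n.
    by exists (mkposreal _ (pos n)).
  by exists p.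
exists phi, l; split => [n|eps e0]; first by case: (hphi n).
have [N [hN /ssrnat.leP N0]] := archimed_cor1 _ e0.
exists N => n /ssrnat.leP Nn; case: (hphi n) => _ h; apply: (Rlt_trans _ _ _ h).
apply: Rle_lt_trans hN; apply: Rinv_le_contravar; first exact/lt_0_INR/ssrnat.leP.
by apply/le_INR/ssrnat.leP; apply: leqW.
Qed.

Definition cvg_coord (K : nat) (x : nat -> 'I_K -> R) (l : 'I_K -> R) : Prop :=
  forall a, Un_cv (fun n => x n a) (l a).

Lemma bounded_cvg_coord_subseq (K : nat) (x : nat -> 'I_K -> R) (rho : R) :
    (forall n a, `|x n a| <= rho) ->
  exists (phi : nat -> nat) (l : 'I_K -> R),
    (forall n, n <= phi n)%N /\ cvg_coord (fun n => x (phi n)) l.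
Proof.
move=> hx.
(* Subsequences are extracted one coordinate at a time; [j] counts the coordinates already
   convergent. *)
suff: forall j, exists (phi : nat -> nat) (l : 'I_K -> R),
    (forall n, n <= phi n)%N /\
    forall a : 'I_K, (a < j)%N -> Un_cv (fun n => x (phi n) a) (l a).
  by move=> /(_ K) [phi [l [h1 h2]]]; exists phi, l; split=> // a; apply: h2.
elim=> [|j [phi [l [h1 h2]]]]; first by exists id, (fun=> 0).
have [Kj|jK] := leqP K j.
  by exists phi, l; split=> // a _; apply: h2; apply: leq_trans Kj.
pose b := Ordinal jK.
have [psi [lb [hpsi hb]]] :=
  @bounded_cv_subseq (fun n => x (phi n) b) rho (fun n => hx _ _).
exists (fun n => phi (psi n)), (fun a => if a == b then lb else l a); split=> [n|a].
  exact: leq_trans (hpsi n) (h1 _).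
rewrite ltnS leq_eqVlt; have [->|ab] := eqVneq a b => //.
move=> aj; apply: (Un_cv_subseq hpsi (h2 a _)).
by case/orP: aj => // aj; case/eqP: ab; apply/val_inj/eqP.
Qed.

Lemma seq_compact_min (K : nat) (S : ('I_K -> R) -> Prop) (h : ('I_K -> R) -> R)
    (x0 : 'I_K -> R) (rho : R) :
    S x0 -> (forall x, S x -> forall a, `|x a| <= rho) ->
    (forall x l, (forall n, S (x n)) -> cvg_coord x l -> S l) ->
    (forall x l, cvg_coord x l -> Un_cv (fun n => h (x n)) (h l)) ->
    (forall x, 0 <= h x) ->
  exists x, S x /\ forall y, S y -> h x <= h y.
Proof.
move=> Sx0 Sb Sc hc h0.
(* The infimum of [h] is obtained as [- m], where [m] is the supremum of [- h]. *)
have [||m [ub lub]] := completeness (fun r => exists y, S y /\ r = Ropp (h y)).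
- exists 0 => _ [y [_ ->]]; have /RleP := h0 y; change 0 with (IZR 0); Lra.lra.
- by exists (Ropp (h x0)), x0.
have /boolp.choice [x hx] : forall n, exists y,
    S y /\ Rlt (h y) (Rplus (Ropp m) (/ INR n.+1)).
  move=> n; apply: boolp.contrapT => hn.
  have pos : Rlt 0 (/ INR n.+1) by apply/Rinv_0_lt_compat/lt_0_INR/ssrnat.leP.
  suff : Rle m (Rminus m (/ INR n.+1)) by move=> h1; Lra.lra.
  apply: lub => _ [y [Sy ->]]; apply: Rnot_lt_le => h1.
  by apply: hn; exists y; split=> //; Lra.lra.
have [phi [l [hphi hl]]] := bounded_cvg_coord_subseq (fun n => Sb _ (proj1 (hx n))).
exists l; split; first by apply: Sc hl => n; case: (hx (phi n)).
move=> y Sy; apply/RleP; have hy : Rle (Ropp (h y)) m by apply: ub; exists y.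
suff : Rle (h l) (Ropp m) by move=> h1; Lra.lra.
apply: Rnot_lt_le => hlm.
(* Half of the supposed gap between [h l] and the infimum; the other half absorbs
   [1 / (phi n + 1)]. *)
pose eps := Rdiv (Rplus (h l) m) 2.
have e0 : Rgt eps 0 by rewrite /eps; Lra.lra.
have [N1 hN1] := hc _ _ hl eps e0.
have [N2 [hN2 /ssrnat.leP N20]] := archimed_cor1 _ e0.
pose n := maxn N1 N2.
have /hN1 : (n >= N1)%coq_nat by apply/ssrnat.leP; rewrite leq_maxl.
have [_ h1] := hx (phi n).
have h2 : Rle (/ INR (phi n).+1) (/ INR N2).
  apply: Rinv_le_contravar; first exact/lt_0_INR/ssrnat.leP.
  apply/le_INR/ssrnat.leP; apply: leqW; apply: leq_trans (hphi n); exact: leq_maxr.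
rewrite /Rdist => /Rabs_def2 [h3 h4].
by rewrite /eps in hN2 h3 h4; Lra.lra.
Qed.

Lemma Un_cv_prodX (J : Type) (r : seq J) (y : nat -> J -> R) (l : J -> R) (b : J -> nat) :
    (forall j, Un_cv (fun n => y n j) (l j)) ->
  Un_cv (fun n => \prod_(j <- r) y n j ^+ b j) (\prod_(j <- r) l j ^+ b j).
Proof.
move=> yl; elim: r => [|j r IH].
  by apply: (Un_cv_ext (fun=> 1)) => [n|]; rewrite big_nil //; apply: Un_cv_const.
rewrite big_cons.
apply: (Un_cv_ext (fun n => Rmult (y n j ^+ b j) (\prod_(j <- r) y n j ^+ b j))).
  by move=> n; rewrite big_cons.
apply: CV_mult => //; elim: (b j) => [|e IHe].
  by apply: (Un_cv_ext (fun=> 1)) => [n|]; rewrite expr0 //; apply: Un_cv_const.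
rewrite exprS; apply: (Un_cv_ext (fun n => Rmult (y n j) (y n j ^+ e))).
  by move=> n; rewrite exprS.
exact: CV_mult.
Qed.

Lemma meval_cv (K : nat) (x : nat -> 'I_K -> R) (l : 'I_K -> R) (p : {mpoly R[K]}) :
  cvg_coord x l -> Un_cv (fun n => p.@[x n]) (p.@[l]).
Proof.
move=> xl; elim/mpolyind: p => [|c m p _ _ IH].
  by apply: (Un_cv_ext (fun=> 0)) => [n|]; rewrite ?meval0 //; apply: Un_cv_const.
apply: (Un_cv_ext (fun n => Rplus (Rmult c (\prod_i x n i ^+ m i)) p.@[x n])).
  by move=> n; rewrite mevalD mevalZ mevalX.
rewrite mevalD mevalZ mevalX; apply: CV_plus => //; apply: CV_mult.
  exact: Un_cv_const.
exact: Un_cv_prodX.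
Qed.

Lemma Un_cv_ge0 (u : nat -> R) (l : R) : (forall n, 0 <= u n) -> Un_cv u l -> 0 <= l.
Proof.
move=> u0 ul; apply/RleP; apply: Rnot_lt_le => l0.
have {}l0 : Rlt l (IZR 0) by [].
have [|N /(_ N (le_n N))] := ul (Ropp l); first by Lra.lra.
have /RleP h : 0 <= u N by [].
have {}h : Rle (IZR 0) (u N) by [].
by rewrite /Rdist => /Rabs_def2 [h1 h2]; Lra.lra.
Qed.

Lemma finite_small (J : finType) (P : J -> R -> Prop) :
    (forall j, exists2 eta, 0 < eta & forall e, 0 < e <= eta -> P j e) ->
  exists2 eta, 0 < eta & forall j e, 0 < e <= eta -> P j e.
Proof.
move=> hP.
suff [eta eta0 h] : exists2 eta, 0 < eta &
    forall j, j \in enum J -> forall e, 0 < e <= eta -> P j e.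
  by exists eta => // j; apply: h; rewrite mem_enum.
elim: (enum J) => [|j r [eta eta0 h]]; first by exists 1.
have [eta' eta'0 h'] := hP j.
exists (Num.min eta eta'); first by rewrite lt_min eta0.
move=> i; rewrite inE => /orP [/eqP ->|ir] e; rewrite le_min => /and3P[e0 e1 e2].
  by apply: h'; rewrite e0.
by apply: (h i ir); rewrite e0.
Qed.

Lemma poly_pos_near0 (p : {poly R}) : 0 < p.[0] ->
  exists2 eta, 0 < eta & forall t, `|t| <= eta -> 0 < p.[t].
Proof.
move=> p0; have [e e0 he] := poly_cont 0 p p0.
exists (e / 2); first by rewrite divr_gt0.
move=> t te; have := he t; rewrite subr0 => /(_ _).
have h : `|t| < e by apply: le_lt_trans te _; lra.
by move=> /(_ h); rewrite ltr_norml => /andP[h1 _]; lra.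
Qed.

(** * Differentiation along coordinate lines *)

(** The constraints are strict at 0, so they hold for small [t] of both signs and Fermat's argument
    applies. *)
Lemma poly_local_max_deriv (J : finType) (p : J -> {poly R}) (q : {poly R}) :
    (forall j, 0 < (p j).[0]) ->
    (forall t, (forall j, 0 <= (p j).[t]) -> q.[t] <= q.[0]) ->
  q^`().[0] = 0.
Proof.
move=> p0 hq.
(* [q1] is the difference quotient [(q - q(0)) / X], and [q1(0)] is the derivative. If it were
   nonzero, its sign would persist near 0 and [q] would exceed [q(0)] on one side. *)
pose q1 := \poly_(i < size q) q`_i.+1.
have qE : q = q1 * 'X + (q.[0])%:P.
  apply/polyP => -[|i]; rewrite coefD coefMX coefC /=.
    by rewrite add0r horner_coef0.
  rewrite addr0 coef_poly; case: ltnP => // h; rewrite nth_default //.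
  exact: leq_trans h _.
have -> : q^`().[0] = q1.[0].
  by rewrite qE derivD derivM derivX derivC addr0 mulr1 !hornerE /= ?mulr0 ?add0r.
have [eta eta0 heta] : exists2 eta, 0 < eta & forall j e, 0 < e <= eta ->
    0 < (p j).[e] /\ 0 < (p j).[- e].
  apply: finite_small => j; have [eta eta0 h] := poly_pos_near0 (p0 j).
  exists eta => // e /andP [e0 ee]; split; apply: h.
    by rewrite gtr0_norm.
  by rewrite normrN gtr0_norm.
have qt t : q.[t] - q.[0] = q1.[t] * t.
  by rewrite {1}qE !hornerE /=; ring.
apply/eqP; rewrite eq_le; apply/andP; split; rewrite leNgt; apply/negP => h.
  have [eta' eta'0 h'] := poly_pos_near0 h.
  pose t := Num.min eta eta'.
  have t0 : 0 < t by rewrite lt_min eta0.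
  have /hq : forall j, 0 <= (p j).[t].
    by move=> j; apply/ltW; apply: (heta j t _).1; rewrite t0 ge_min lexx.
  rewrite -subr_le0 qt leNgt mulr_gt0 //.
  by apply: h'; rewrite gtr0_norm // ge_min lexx orbT.
have h0 : 0 < (- q1).[0] by rewrite hornerN oppr_gt0.
have [eta' eta'0 h'] := poly_pos_near0 h0.
pose t := Num.min eta eta'.
have t0 : 0 < t by rewrite lt_min eta0.
have /hq : forall j, 0 <= (p j).[- t].
  by move=> j; apply/ltW; apply: (heta j t _).2; rewrite t0 ge_min lexx.
rewrite -subr_le0 qt leNgt mulrN -mulNr mulr_gt0 // -hornerN.
by apply: h'; rewrite normrN gtr0_norm // ge_min lexx orbT.
Qed.

Section RestrictionToLine.

Variables (K : nat) (w : 'I_K -> R) (a : 'I_K).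

Let dir (b : 'I_K) : {poly R} := (w b)%:P + (a == b)%:R *: 'X.
Definition line_poly (p : {mpoly R[K]}) : {poly R} := mmap polyC dir p.

Lemma horner_line_poly p t :
  (line_poly p).[t] = p.@[fun b => w b + t * (a == b)%:R].
Proof.
elim/mpolyind: p => [|c m p _ _ IH]; first by rewrite /line_poly mmap0 meval0 horner0.
rewrite /line_poly mmapD mmapZ mmapX mevalD mevalZ mevalX hornerD -/(line_poly p) IH.
rewrite hornerM hornerC; congr (_ * _ + _); rewrite horner_prod.
by apply: eq_bigr => b _; rewrite horner_exp !hornerE mulrC.
Qed.

Lemma deriv_line_poly p : (line_poly p)^`() = line_poly p^`M(a).
Proof.
elim/mpolyind: p => [|c m p _ _ IH].
  by rewrite mderiv0 /line_poly mmap0 deriv0.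
rewrite mderivD mderivZ mderivX scalerA /line_poly !mmapD !mmapZ !mmapX derivD.
rewrite -!/(line_poly _) IH; congr (_ + _).
rewrite derivM derivC mul0r add0r rmorphM -mulrA; congr (_ * _).
have dira : (dir a)^`() = 1 by rewrite derivD derivC add0r eqxx scale1r derivX.
rewrite /mmap1 (bigD1 a) //= [in RHS](bigD1 a) //= derivM.
have -> : (\prod_(i < K | i != a) dir i ^+ m i)^`() = 0.
  have -> : \prod_(i < K | i != a) dir i ^+ m i = (\prod_(i < K | i != a) w i ^+ m i)%:P.
    rewrite rmorph_prod; apply: eq_bigr => i ia.
    by rewrite /dir eq_sym (negPf ia) scale0r addr0 rmorphXn.
  by rewrite derivC.
rewrite mulr0 addr0 deriv_exp dira mul1r mnmBE mnm1E eqxx subn1.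
rewrite -mulr_natl -mulrA; congr (_ * (_ * _)); first by rewrite rmorph_nat.
apply: eq_bigr => i ia; by rewrite mnmBE mnm1E eq_sym (negPf ia) subn0.
Qed.

End RestrictionToLine.

Lemma logderiv_prodX (K : nat) (J : eqType) (r : seq J) (f : J -> {mpoly R[K]})
    (s : J -> nat) (w : 'I_K -> R) (a : 'I_K) :
    (forall j, (f j).@[w] != 0) ->
  (\prod_(j <- r) f j ^+ s j)^`M(a).@[w] =
  (\prod_(j <- r) f j ^+ s j).@[w] *
    \sum_(j <- r) (s j)%:R * (f j)^`M(a).@[w] / (f j).@[w].
Proof.
move=> fw; elim: r => [|j r IH].
  by rewrite !big_nil -mpolyC1 mderivC meval0 mulr0.
rewrite !big_cons mderivM mevalD !mevalM IH mulrDr; congr (_ + _); last by rewrite mulrA.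
rewrite mulrAC; congr (_ * _).
elim: (s j) => [|e IHe].
  by rewrite expr0 -mpolyC1 mderivC meval0 !mul0r mulr0.
rewrite exprS mderivM mevalD !mevalM IHe -natr1.
by field; exact: fw.
Qed.

(** The last hypothesis bounds the closed cell, so [H] attains a maximum on it. As [H] is positive
    at [w0] and zero wherever some [f j] vanishes, the maximum lies in the open cell, and its
    first-order condition is the stated system. *)
Lemma critical_point (K M : nat) (f : 'I_M -> {mpoly R[K]}) (s : 'I_M -> nat)
    (c w0 : 'I_K -> R) (rho : R) :
    (forall j, 0 < s j)%N -> (forall j, 0 < (f j).@[w0]) ->
    (forall w, (forall j, 0 <= (f j).@[w]) -> forall a, `|w a| <= rho) ->
  exists w, (forall j, 0 < (f j).@[w]) /\
    forall a, \sum_j (s j)%:R * (f j)^`M(a).@[w] / (f j).@[w] = c a.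
Proof.
move=> s0 fw0 fbd.
pose P : {mpoly R[K]} := \prod_j f j ^+ s j.
pose L : {mpoly R[K]} := \sum_a c a *: 'X_a.
have LE w : L.@[w] = \sum_a c a * w a.
  by rewrite raddf_sum /=; apply: eq_bigr => a _; rewrite mevalZ mevalXU.
have PE w : P.@[w] = \prod_j (f j).@[w] ^+ s j.
  by rewrite rmorph_prod; apply: eq_bigr => j _; rewrite rmorphXn.
pose H w := P.@[w] * exp (- L.@[w])%R.
have Hcv x l : cvg_coord x l -> Un_cv (fun n => H (x n)) (H l).
  move=> xl; apply: CV_mult; first exact: meval_cv.
  apply: (continuity_seq exp).
    exact/derivable_continuous_pt/derivable_pt_exp.
  by apply: CV_opp; apply: meval_cv.
(* A nonnegative function is to be minimised: [exp (- H)] is positive and decreasing in [H]. *)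
have [|||||w [fw hw]] := @seq_compact_min K (fun w => forall j, 0 <= (f j).@[w])
    (fun w => exp (- H w)) w0 rho.
- by move=> j; apply/ltW.
- exact: fbd.
- move=> x l Sx xl j; apply: Un_cv_ge0 (meval_cv (f j) xl) => n; exact: Sx.
- move=> x l xl; apply: (continuity_seq exp).
    exact/derivable_continuous_pt/derivable_pt_exp.
  by apply: CV_opp; apply: Hcv.
- by move=> x; apply/RleP/Rlt_le/exp_pos.
have {}hw y : (forall j, 0 <= (f j).@[y]) -> H y <= H w.
  move=> /hw /RleP h; apply/RleP; apply: Rnot_lt_le => h1.
  have : Rlt (exp (- H y)) (exp (- H w)) by apply/exp_increasing/Ropp_lt_contravar.
  by move/Rlt_not_le; apply.
have expgt0 x : 0 < exp x :> R by apply/RltP/exp_pos.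
have fwn0 j : (f j).@[w] != 0.
  apply/negP => /eqP fj0.
  have : H w0 <= H w by apply: hw => i; apply/ltW.
  apply/negP; rewrite -ltNge /H PE [X in X * _ < _](bigD1 j) //= fj0 expr0n.
  rewrite eqn0Ngt s0 !mul0r mulr_gt0 // PE prodr_gt0 // => i _.
  by rewrite exprn_gt0.
have {}fw j : 0 < (f j).@[w] by rewrite lt_def fwn0 fw.
exists w; split=> // a.
have Pw : 0 < P.@[w] by rewrite PE prodr_gt0 // => i _; rewrite exprn_gt0.
suff: P^`M(a).@[w] = P.@[w] * c a.
  rewrite logderiv_prodX //; apply: mulfI; exact: lt0r_neq0.
have w0E (p : {mpoly R[K]}) : (line_poly w a p).[0] = p.@[w].
  by rewrite horner_line_poly; apply: meval_eq => b; rewrite mul0r addr0.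
(* [exp (- c t) >= 1 - c t] replaces the exponential factor by a polynomial one *)
pose q := line_poly w a P * (1 - c a *: 'X).
have: q^`().[0] = 0.
  apply: (@poly_local_max_deriv _ (fun j => line_poly w a (f j))) => [j|t ht].
    by rewrite w0E.
  pose y b := w b + t * (a == b)%:R.
  have Sy j : 0 <= (f j).@[y] by have := ht j; rewrite horner_line_poly.
  have := hw y Sy.
  have -> : H y = (line_poly w a P).[t] * exp (- (c a * t))%R * exp (- L.@[w])%R.
    rewrite -mulrA expRD /H horner_line_poly; congr (_ * exp _).
    change (- L.@[y] = - (c a * t) + - L.@[w] :> R).
    rewrite -opprD; congr (- _).
    rewrite !LE addrC -[c a * t](_ : \sum_b c b * (t * (a == b)%:R) = _).
      by rewrite -big_split /=; apply: eq_bigr => b _; rewrite mulrDr.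
    rewrite (bigD1 a) //= eqxx mulr1 big1 ?addr0 // => b ba.
    by rewrite eq_sym (negPf ba) !mulr0.
  rewrite /H ler_pM2r // => h1.
  rewrite /q !hornerE /= w0E ?mulr0 ?subr0 ?mulr1.
  apply: le_trans h1; rewrite ler_wpM2l //.
    rewrite horner_line_poly PE prodr_ge0 // => j _.
    rewrite exprn_ge0 //; exact: Sy.
  apply/RleP; have := exp_ineq1_le (- (c a * t)).
  by rewrite -RplusE.
(* At 0 the derivative of [q] is the partial derivative of [P] in direction [a] minus [c a] times
   [P]. *)
rewrite /q derivM !hornerE /= derivB derivZ derivX -polyC1 derivC !hornerE /=.
rewrite deriv_line_poly !w0E; lra.
Qed.

(** * Counting sign cells *)

Lemma meval_subst (n n' : nat) (F : comNzRingType) (p : {mpoly F[n']})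
    (h : 'I_n' -> {mpoly F[n]}) (z : 'I_n -> F) :
  (mmap (@mpolyC n F) h p).@[z] = p.@[fun v => (h v).@[z]].
Proof.
rewrite [in RHS]mevalE /mmap raddf_sum /=; apply: eq_bigr => m _.
rewrite mevalM mevalC rmorph_prod; congr (_ * _).
by apply: eq_bigr => v _; rewrite rmorphXn.
Qed.

Lemma prod_option (I : finType) (E : option I -> nat) :
  (\prod_i E i = E None * \prod_i E (Some i))%N.
Proof.
rewrite (bigD1 None) //=; congr (_ * _)%N.
rewrite (reindex_omap Some id) => [|[i|] //].
by apply: eq_bigl => i; rewrite eqxx.
Qed.

Section SignCells.

Variables (K m : nat) (I T : finType) (blk : 'I_K -> I) (d : I -> nat).
Variables (f : 'I_m -> {mpoly R[K]}) (w : T -> 'I_K -> R).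

Hypothesis d_gt0 : forall i, (0 < d i)%N.
Hypothesis f_degree : forall j, block_degree_le (fun v i => blk v == i) (f j) d.
Hypothesis f_neq0 : forall t j, (f j).@[w t] != 0.
Hypothesis f_signs : forall t t', t != t' ->
  exists j, (f j).@[w t] * (f j).@[w t'] < 0.

Let M := (m + (K + K))%N.
Let rho : R := 1 + \sum_t \sum_a `|w t a|.

(** The [f j] are followed by the [2 K] box polynomials [rho - X_a] and [rho + X_a]. Since [rho]
    exceeds every [|w t a|], these are positive at all the points [w t]. *)
Let h (v : 'I_M) : {mpoly R[K]} :=
  match split v with
  | inl j => f j
  | inr v' => match split v' with
              | inl a => rho%:MP - 'X_a
              | inr a => rho%:MP + 'X_a
              end
  end.

Let h_f j : h (lshift _ j) = f j.
Proof. by rewrite /h (unsplitK (inl _ j)). Qed.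

Let h_lt a : h (rshift _ (lshift _ a)) = rho%:MP - 'X_a.
Proof. by rewrite /h (unsplitK (inr _ _)) (unsplitK (inl _ _)). Qed.

Let h_gt a : h (rshift _ (rshift _ a)) = rho%:MP + 'X_a.
Proof. by rewrite /h (unsplitK (inr _ _)) (unsplitK (inr _ _)). Qed.

Let w_lt_rho t a : `|w t a| < rho.
Proof.
rewrite /rho (bigD1 t) //= (bigD1 a) //= ltr_pwDl // -addrA lerDl addr_ge0 //.
  exact: sumr_ge0.
by apply: sumr_ge0 => i _; apply: sumr_ge0.
Qed.

Let h_degree v : block_degree_le (fun v i => blk v == i) (h v) d.
Proof.
rewrite /h; case: (split v) => [j|v'] //; case: (split v') => a.
  apply: block_degreeD; first exact: block_degreeC.
  by apply: block_degreeN; apply: block_degreeXU.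
by apply: block_degreeD; [apply: block_degreeC | apply: block_degreeXU].
Qed.

Let h_neq0 t v : (h v).@[w t] != 0.
Proof.
have := w_lt_rho t; rewrite /h; case: (split v) => [j|v'] // wr.
by case: (split v') => a; have := wr a; rewrite ltr_norml => /andP[h1 h2];
  rewrite ?mevalB ?mevalD mevalC mevalXU lt0r_neq0 //; lra.
Qed.

Let cell_critical_point t (s : 'I_M -> nat) (c : 'I_K -> nat) : exists y : 'I_K -> R,
  (forall v, 0 < (h v).@[w t] * (h v).@[y]) /\
  (forall a, \sum_v (s v).+1%:R / (h v).@[y] * (h v)^`M(a).@[y] = (c a).+1%:R).
Proof.
(* Scaling by its value at [w t] makes each polynomial positive there and leaves its logarithmic
   derivative unchanged. *)
pose g v := (h v).@[w t] *: h v.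
have [|||y [gy cy]] := @critical_point K M g (fun v => (s v).+1)
    (fun a => (c a).+1%:R) (w t) rho.
- by [].
- by move=> v; rewrite mevalZ lt_def mulf_neq0 // -expr2 sqr_ge0.
- move=> y gy a.
  have := gy (rshift _ (lshift _ a)); have := gy (rshift _ (rshift _ a)).
  rewrite /g h_lt h_gt !mevalZ !(mevalB, mevalD) !mevalC !mevalXU.
  have := w_lt_rho t a; rewrite ltr_norml => /andP[h1 h2].
  rewrite !pmulr_rge0; try lra.
  by move=> h3 h4; rewrite ler_norml; apply/andP; split; lra.
exists y; split=> [v|a]; first by have := gy v; rewrite mevalZ.
rewrite -cy; apply: eq_bigr => v _; rewrite mderivZ !mevalZ.
have hy0 : (h v).@[y] != 0.
  by have := gy v; rewrite mevalZ; apply: contraTneq => ->; rewrite mulr0 ltxx.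
by field; rewrite hy0 h_neq0.
Qed.

Let n := (M + K)%N.
Let lift (p : {mpoly R[K]}) : {mpoly R[n]} :=
  mmap (@mpolyC n R) (fun a => 'X_(rshift M a)) p.
(** The [M] auxiliary variables [u_j] form the extra block [None], of degree 1. *)
Let blk' (v : 'I_n) : option I := if split v is inr a then Some (blk a) else None.
Let d' (i : option I) := if i is Some i then d i else 1%N.

Let G (v : 'I_n) : {mpoly R[n]} :=
  match split v with
  | inl j => 'X_(lshift K j) * lift (h j)
  | inr a => \sum_j 'X_(lshift K j) * lift (h j)^`M(a)
  end.

Let G_degree v : block_degree_le (fun v i => blk' v == i) (G v) d'.
Proof.
have key j p : block_degree_le (fun v i => blk v == i) p d ->
    block_degree_le (fun v i => blk' v == i) ('X_(lshift K j) * lift p) d'.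
  move=> pd.
  have hX : block_degree_le (fun v i => blk' v == i) ('X_(lshift K j) : {mpoly R[n]})
      (fun i => (i == None : nat)).
    by apply: block_degreeXU => i; rewrite /blk' (unsplitK (inl _ j)) => /eqP <-.
  have hL : block_degree_le (fun v i => blk' v == i) (lift p)
      (fun i => if i is Some i then d i else 0%N).
    apply: (@block_degree_subst _ _ _ _ _ _ _ (fun a i => (Some (blk a) == i : nat))).
      move=> a; apply: block_degreeXU => i.
      by rewrite /blk' (unsplitK (inr _ a)) => ->.
    move=> m' m'p [i|]; last by rewrite big1 // => a _; rewrite muln0.
    apply: leq_trans (pd m' m'p i); rewrite [leqRHS]big_mkcond /=.
    by apply: leq_sum => a _; rewrite (inj_eq Some_inj); case: eqP; rewrite ?muln1 ?muln0.
  by apply: block_degree_leW (block_degreeM hX hL) _ => -[i|].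
rewrite /G; case: (split v) => [j|a]; first by apply: key; apply: h_degree.
by apply: block_degree_sum => j _; apply/key/block_degree_mderiv/h_degree.
Qed.

Let meval_lift p z : (lift p).@[z] = p.@[fun a => z (rshift M a)].
Proof. by rewrite meval_subst; apply: meval_eq => a; rewrite mevalXU. Qed.

Let G_fibers (c : 'I_n -> nat) : exists z : T -> 'I_n -> R,
  (forall t t', t != t' -> exists v, z t v != z t' v) /\
  (forall t v, (G v).@[z t] = (c v).+1%:R).
Proof.
have [y hy] := fin_all_exists (fun t =>
  cell_critical_point t (fun v => c (lshift K v)) (fun a => c (rshift M a))).
pose z t (v : 'I_n) := match split v with
  | inl j => (c v).+1%:R / (h j).@[y t]
  | inr a => y t a
  end.
have zl t j : z t (lshift K j) = (c (lshift K j)).+1%:R / (h j).@[y t].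
  by rewrite /z (unsplitK (inl _ j)).
have zr t a : z t (rshift M a) = y t a.
  by rewrite /z (unsplitK (inr _ a)).
have lz t p : (lift p).@[z t] = p.@[y t].
  by rewrite meval_lift; apply: meval_eq => a; rewrite zr.
exists z; split=> [t t' tt'|t v].
  (* If the weight parts [y t] and [y t'] coincided, [f j] would have there both the sign it has at
     [w t] and the opposite sign it has at [w t']. *)
  have [j fj] := f_signs tt'.
  have [/existsP [a ya]|] := boolP [exists a, y t a != y t' a].
    by exists (rshift M a); rewrite !zr.
  rewrite negb_exists => /forallP ya.
  have e : (f j).@[y t] = (f j).@[y t'].
    by apply: meval_eq => a; apply/eqP; have := ya a; rewrite negbK.
  have := (hy t).1 (lshift _ j); have := (hy t').1 (lshift _ j).
  rewrite h_f e => h1 h2; exfalso.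
  have : 0 < (f j).@[w t] * (f j).@[w t'] * ((f j).@[y t'] ^+ 2) by nra.
  by apply/negP; rewrite -leNgt mulr_le0_ge0 ?sqr_ge0 // ltW.
rewrite /G; case: (split_ordP v) => [j|a] ->.
  rewrite mevalM mevalXU zl lz divfK //.
  by have := (hy t).1 j; apply: contraTneq => ->; rewrite mulr0 ltxx.
rewrite raddf_sum /= -[RHS](hy t).2; apply: eq_bigr => j _.
by rewrite mevalM mevalXU zl lz.
Qed.

(** The Bezout inequality in [n = M + K] variables carries [M!] on the left from the block of the
    [u_j]. The quotient [n! / M!] is at most [n ^ K], and [n = m + 3 * K]. *)
Lemma sign_cells_bound :
  (#|T| * \prod_i #|[pred v | blk v == i]|`! <=
    (m + 3 * K) ^ K * \prod_i d i ^ #|[pred v | blk v == i]|)%N.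
Proof.
have := multihomogeneous_bezout G_degree G_fibers; rewrite !prod_option.
have -> : #|[pred v | blk' v == None]| = M.
  rewrite -sum1_card big_split_ord /= -[RHS]addn0; congr (_ + _)%N.
    rewrite (eq_bigl predT) ?sum1_card ?card_ord // => j.
    by rewrite inE /blk' (unsplitK (inl _ j)).
  by rewrite big_pred0 // => a; rewrite inE /blk' (unsplitK (inr _ a)).
have kE i : #|[pred v | blk' v == Some i]| = #|[pred v | blk v == i]|.
  rewrite -!sum1_card big_split_ord /= big_pred0 => [|j]; last first.
    by rewrite inE /blk' (unsplitK (inl _ j)).
  rewrite add0n; apply: eq_bigl => a.
  by rewrite !inE /blk' (unsplitK (inr _ a)).
under eq_bigr do rewrite kE; under [X in (_ <= _ * (_ * X))%N]eq_bigr do rewrite kE.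
rewrite /d' exp1n mul1n => /(_ _).
have hd i : (0 < d' i)%N by case: i.
move=> /(_ hd); rewrite mulnCA => hle.
rewrite -(leq_pmul2l (fact_gt0 M)); apply: leq_trans hle _.
rewrite mulnA leq_mul2r; apply/orP; right.
have -> : n`! = (n ^_ K * M`!)%N.
  by rewrite -[M]addn0 -(subnn K) addnBA // -/n ffact_fact // leq_addl.
rewrite mulnC leq_mul2l; apply/orP; right.
have -> : (m + 3 * K = n)%N by rewrite /n /M; lia.
exact: ffact_le_expn.
Qed.

End SignCells.

(** * Network outputs as polynomials in the weights *)

Section NetworkPolynomials.

Variables (l : nat) (q k alpha beta : nat -> nat).
Variable tau : forall i j : nat, mpoly.mpoly (k i + q i.-1) R.

Definition net_var := {i : 'I_l & 'I_(k i.+1)}.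
Definition net_block (v : 'I_#|{: net_var}|) : 'I_l := tag (enum_val v).

Definition flat_weights (w : forall i, 'I_(k i) -> R) (v : 'I_#|{: net_var}|) : R :=
  w (tag (enum_val v)).+1 (tagged (enum_val v)).

(** Layers are numbered from 1 but ['I_l] from 0, so the weights of layer [i.+1] form block [i]. The
    value 0 is a default for [i >= l]. *)
Definition weight_poly (i : nat) (a : 'I_(k i.+1)) : {mpoly R[#|{: net_var}|]} :=
  match @idP (i < l)%N with
  | ReflectT il =>
      'X_(enum_rank (Tagged (fun i : 'I_l => 'I_(k i.+1)) (i := Ordinal il) a))
  | ReflectF _ => 0
  end.

Fixpoint layer_poly (N : nat) (x : 'rV[R]_N) (i : nat) :
    nat -> {mpoly R[#|{: net_var}|]} :=
  match i with
  | 0 => fun j => (match insub j with Some o => x 0 o | None => 0 end)%:MP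
  | i'.+1 => fun j =>
      mmap (@mpolyC _ R)
        (fun v : 'I_(k i'.+1 + q i') =>
           match split v with
           | inl a => weight_poly a
           | inr b => layer_poly x i' (nat_of_ord b)
           end)
        (tau i'.+1 j)
  end.

Lemma meval_layer_poly (N : nat) (x : 'rV[R]_N) (w : forall i, 'I_(k i) -> R) i j :
  (i <= l)%N -> (layer_poly x i j).@[flat_weights w] = layer (q := q) tau w x i j.
Proof.
elim: i j => [|i IH] j il; first by rewrite /= mevalC.
rewrite /= meval_subst; apply: meval_eq => v.
case: (split v) => [a|b]; last by apply: IH; apply: ltnW.
rewrite /weight_poly; case: {-}_ / idP => // il'; rewrite mevalXU /flat_weights.
by rewrite enum_rankK.
Qed.

(** Block [i'] first enters in layer [i'.+1] with degree [alpha], and each later layer multiplies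
    the degree by its [beta]. At [i = l] this is [dlayer alpha beta l i'.+1]. *)
Definition layer_degree (i : nat) (i' : 'I_l) : nat :=
  if (i' < i)%N then (alpha i'.+1 * \prod_(i'.+2 <= j < i.+1) beta j)%N else 0%N.

Hypothesis htau : forall i j, (1 <= i <= l)%N -> (j < q i)%N ->
  split_degree_le (tau i j) (alpha i) (beta i).

Lemma layer_poly_degree (N : nat) (x : 'rV[R]_N) i j :
    (i <= l)%N -> (j < q i)%N ->
  block_degree_le (fun v i => net_block v == i) (layer_poly x i j) (layer_degree i).
Proof.
elim: i j => [|i IH] j il jq; first exact: block_degreeC.
rewrite /=; apply: (@block_degree_subst _ _ _ _ (k i.+1 + q i) _ _
  (fun (v : 'I_(k i.+1 + q i)) (i' : 'I_l) =>
  match split v with inl _ => (i' == i :> nat : nat) | inr _ => layer_degree i i' end)).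
  move=> v; case: (split v) => [a|b]; last by apply: IH => //; apply: ltnW.
  rewrite /weight_poly; case: {-}_ / idP => // il'.
  apply: block_degreeXU => i'; rewrite /net_block enum_rankK /= => /eqP <-.
  by rewrite eqxx.
move=> m' m'p i'; have [ha hb] := @htau i.+1 j il jq m' m'p.
rewrite big_split_ord /=.
under eq_bigr do rewrite (unsplitK (inl _ _)).
under [X in (_ + X <= _)%N]eq_bigr do rewrite (unsplitK (inr _ _)).
rewrite -!big_distrl /=.
apply: leq_trans (leq_add (leq_mul ha (leqnn _)) (leq_mul hb (leqnn _))) _.
(* An earlier block gains the factor [beta i.+1], a later block is absent, and block [i] is the
   fresh one, whose product of [beta] is empty. *)
rewrite /layer_degree; case: (ltngtP i' i) => [lt|gt|e].
- have -> : (i' < i.+1)%N by lia.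
  rewrite muln0 add0n [in leqRHS]big_nat_recr //= mulnCA leq_mul2l mulnC.
  by rewrite leqnn orbT.
- by rewrite !muln0.
- by rewrite -e ltnS leqnn muln1 muln0 addn0 big_geq // muln1.
Qed.

Lemma card_net_block (i : 'I_l) : #|[pred v | net_block v == i]| = k i.+1.
Proof.
rewrite -sum1_card (reindex _ (onW_bij _ (enum_rank_bij {: net_var}))) /=.
rewrite (eq_bigl (fun u : net_var => tag u == i)) => [|u]; last first.
  by rewrite inE /net_block enum_rankK.
rewrite sum1_card -[RHS]card_ord.
pose g (a : 'I_(k i.+1)) : net_var := Tagged (fun i : 'I_l => 'I_(k i.+1)) a.
have ginj : injective g by move=> a b /eqP; rewrite eq_Tagged => /eqP.
rewrite -(card_imset _ ginj); apply: eq_card => u; rewrite unfold_in.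
apply/idP/imsetP => [|[a _ ->]]; last exact: eqxx.
by case: u => i1 a e; have {}e : i1 = i by [apply/eqP]; subst i1; exists a.
Qed.

Lemma card_net_var : #|{: net_var}| = (\sum_(i < l) k i.+1)%N.
Proof.
rewrite -[LHS]card_ord -sum1_card (partition_big net_block predT) //=.
by apply: eq_bigr => i _; rewrite -card_net_block [RHS](esym (sum1_card _)).
Qed.

End NetworkPolynomials.

Lemma dlayer_gt0 (l : nat) (alpha beta : nat -> nat) (i : 'I_l) :
    (forall i, (1 <= i <= l)%N -> (1 <= alpha i)%N) ->
    (forall i, (1 <= i <= l)%N -> (1 <= beta i)%N) ->
  (0 < dlayer alpha beta l i.+1)%N.
Proof.
move=> ha hb; rewrite muln_gt0 ha ?ltn_ord //= big_seq; apply: prodn_cond_gt0 => j.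
rewrite mem_index_iota => /andP [h1 h2]; apply: hb; lia.
Qed.

(** Shattering realises every sign pattern, so [T] is the set of all [2 ^ size X] patterns. The weak
    inequality defining the output 1 is made strict by adding a small constant to the outputs. *)
Lemma shattered_count (N l : nat) (q k alpha beta : nat -> nat)
    (tau : forall i j : nat, mpoly.mpoly (k i + q i.-1) R) (X : seq 'rV[R]_N) :
    q l = 1%N ->
    (forall i, (1 <= i <= l)%N -> (1 <= alpha i)%N) ->
    (forall i, (1 <= i <= l)%N -> (1 <= beta i)%N) ->
    (forall i j, (1 <= i <= l)%N -> (j < q i)%N ->
       split_degree_le (tau i j) (alpha i) (beta i)) ->
    uniq X -> shattered (q := q) tau l X ->
  (2 ^ size X * \prod_(i < l) (k i.+1)`! <=
    (size X + 3 * ksum k l) ^ ksum k l *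
      \prod_(i < l) dlayer alpha beta l i.+1 ^ k i.+1)%N.
Proof.
move=> ql ha hb htau uX shX.
pose m := size X; pose x (j : 'I_m) : 'rV[R]_N := tnth (in_tuple X) j.
pose T := {ffun 'I_m -> bool}.
have xinj : injective x.
  move=> j1 j2; rewrite /x !(tnth_nth 0) /= => /eqP.
  by rewrite nth_uniq // => /eqP/val_inj.
have ex (t : T) : exists w : forall i, 'I_(k i) -> R,
    forall j, (0 <= net_output (q := q) tau w (x j) l) = t j.
  have [w hw] := shX (fun y => if [pick j | x j == y] is Some j then t j else false).
  exists w => j; have := hw (x j) (mem_tnth j (in_tuple X)); rewrite /net_phi => ->.
  case: pickP => [j' /eqP /xinj -> //|/(_ j)]; by rewrite eqxx.
have [w hw] := fin_all_exists ex.
(* One shift serves all patterns and points: a nonnegative output becomes positive, and a negative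
   output [y] stays negative for shifts up to [- y / 2]. *)
have [eta eta0 heta] : exists2 eta : R, 0 < eta &
    forall (tj : T * 'I_m) e, 0 < e <= eta ->
    0 < (-1) ^+ (~~ tj.1 tj.2) * (net_output (q := q) tau (w tj.1) (x tj.2) l + e).
  apply: finite_small => -[t j] /=; have := hw t j.
  set y := net_output _ _ _ _; case: (t j) => hy.
    exists 1 => // e /andP [e0 _]; rewrite expr0 mul1r; exact: ltr_wpDl.
  have y0 : y < 0 by rewrite ltNge hy.
  by exists (- y / 2) => [|e /andP[e0 e1]]; rewrite ?expr1; lra.
pose f (j : 'I_m) : {mpoly R[#|{: net_var l k}|]} := layer_poly l tau (x j) l 0 + eta%:MP.
have fE t j : (f j).@[flat_weights (w t)] = net_output (q := q) tau (w t) (x j) l + eta.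
  by rewrite mevalD mevalC meval_layer_poly.
have fpos (t : T) j : 0 < (-1) ^+ (~~ t j) * (f j).@[flat_weights (w t)].
  by rewrite fE; apply: (heta (t, j)); rewrite eta0 lexx.
have dgt0 (i : 'I_l) := dlayer_gt0 i ha hb.
have fdeg j : block_degree_le (fun v i => net_block v == i) (f j)
    (fun i : 'I_l => dlayer alpha beta l i.+1).
  apply: block_degreeD; last exact: block_degreeC.
  have := @layer_poly_degree l q k alpha beta tau htau N (x j) l 0.
  rewrite ql => /(_ (leqnn _) isT) hd; apply: (block_degree_leW hd) => i.
  by rewrite /layer_degree ltn_ord.
have fn0 t j : (f j).@[flat_weights (w t)] != 0.
  by have := fpos t j; apply: contraTneq => ->; rewrite mulr0 ltxx.
have fsgn t t' : t != t' -> exists j,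
    (f j).@[flat_weights (w t)] * (f j).@[flat_weights (w t')] < 0.
  move=> tt'; have [/existsP [j tj]|] := boolP [exists j, t j != t' j]; last first.
    rewrite negb_exists => /forallP e; case/eqP: tt'; apply/ffunP => j.
    by apply/eqP; have := e j; rewrite negbK.
  exists j; have := fpos t j; have := fpos t' j.
  by move: tj; case: (t j); case: (t' j) => // _; rewrite expr0 expr1 => h1 h2; nra.
have := sign_cells_bound dgt0 fdeg fn0 fsgn.
under eq_bigr do rewrite card_net_block.
under [X in (_ <= _ * X)%N]eq_bigr do rewrite card_net_block.
rewrite card_ffun card_bool card_ord card_net_var.
suff -> : (\sum_(i < l) k i.+1 = ksum k l)%N by [].
by rewrite /ksum big_add1 /= big_mkord.
Qed.

(** * The entropy bound *)

Local Close Scope ring_scope.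
Local Open Scope R_scope.

Lemma INR_gt0 (n : nat) : (0 < n)%N -> 0 < INR n.
Proof. by move=> n0; apply/lt_0_INR/ssrnat.leP. Qed.

Lemma INR_mul (a b : nat) : INR (a * b)%N = INR a * INR b.
Proof. exact: mult_INR. Qed.

Lemma ln_INR_expn (a b : nat) : (0 < a)%N -> ln (INR (a ^ b)%N) = INR b * ln (INR a).
Proof.
move=> a0; rewrite -ln_pow; last exact: INR_gt0.
by rewrite !INRE natrX RpowE.
Qed.

Lemma ln_INR_prod (l : nat) (E : 'I_l -> nat) : (forall i, 0 < E i)%N ->
  ln (INR (\prod_(i < l) E i)%N) = (\sum_(i < l) ln (INR (E i)))%R.
Proof.
elim: l E => [|l IH] E E0; first by rewrite !big_ord0 /= ln_1.
rewrite !big_ord_recr /= INR_mul ln_mult; last 2 first.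
- by apply: INR_gt0; apply: prodn_gt0.
- exact: INR_gt0.
by rewrite IH.
Qed.

Lemma ln_le (x y : R) : 0 < x -> x <= y -> ln x <= ln y.
Proof. by move=> x0 [xy|->]; [left; apply: ln_increasing | right]. Qed.

Lemma ln_le_sub1 (x : R) : 0 < x -> ln x <= x - 1.
Proof. by move=> x0; have := exp_ineq1_le (ln x); rewrite exp_ln //; Lra.lra. Qed.

Lemma ln_div (x y : R) : 0 < x -> 0 < y -> ln (x / y) = ln x - ln y.
Proof.
move=> x0 y0; rewrite /Rdiv ln_mult //; last exact: Rinv_0_lt_compat.
by rewrite ln_Rinv.
Qed.

(** This is [n! >= (n / e) ^ n]; the induction step is [n * ln ((n + 1) / n) <= 1]. *)
Lemma ln_fact_ge (n : nat) : INR n * ln (INR n) - INR n <= ln (INR n`!).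
Proof.
elim: n => [|n IH]; first by rewrite /= ln_1; Lra.lra.
case: (posnP n) IH => [-> _|n0 IH]; first by rewrite /= ln_1; Lra.lra.
have np := INR_gt0 n0.
rewrite factS INR_mul ln_mult; [|exact: INR_gt0|exact: (INR_gt0 (fact_gt0 n))].
rewrite S_INR.
have h : ln ((INR n + 1) / INR n) <= / INR n.
  apply: (Rle_trans _ _ _ (ln_le_sub1 _)); first by apply: Rdiv_lt_0_compat; Lra.lra.
  by right; rewrite /Rdiv Rmult_plus_distr_r Rinv_r; Lra.lra.
rewrite ln_div in h; [|Lra.lra|by []].
have h2 : INR n * (ln (INR n + 1) - ln (INR n)) <= INR n * / INR n.
  by apply: Rmult_le_compat_l => //; Lra.lra.
rewrite Rinv_r in h2; Lra.lra.
Qed.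

Lemma INR_ksum (k : nat -> nat) (l : nat) :
  INR (ksum k l) = (\sum_(i < l) INR (k i.+1))%R.
Proof.
rewrite /ksum big_add1 big_mkord INRE natr_sum.
by apply: eq_bigr => i _; rewrite INRE.
Qed.

(** Each logarithm of a quotient of quotients splits into four, and the two that do not depend on
    [i] are summed using [sum k_i = k]. *)
Lemma scaled_rel_entropy (k alpha beta : nat -> nat) (l : nat) :
    (forall i : 'I_l, 0 < k i.+1)%N ->
    (forall i : 'I_l, 0 < dlayer alpha beta l i.+1)%N ->
    (0 < ksum k l)%N -> (0 < dsum alpha beta l)%N ->
  INR (ksum k l) * rel_entropy k alpha beta l =
  ((\sum_(i < l) INR (k i.+1) * ln (INR (k i.+1)))%R
   - (\sum_(i < l) INR (k i.+1) * ln (INR (dlayer alpha beta l i.+1)))%R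
   + INR (ksum k l) * (ln (INR (dsum alpha beta l)) - ln (INR (ksum k l)))) / ln 2.
Proof.
move=> k0 d0 /INR_gt0 K0 /INR_gt0 D0.
have l2 : ln 2 <> 0 by have := ln_lt_2; Lra.lra.
have -> : rel_entropy k alpha beta l = (\sum_(i < l)
    INR (k i.+1) / INR (ksum k l) * log2 ((INR (k i.+1) / INR (ksum k l)) /
      (INR (dlayer alpha beta l i.+1) / INR (dsum alpha beta l))))%R.
  by rewrite /rel_entropy big_add1 big_mkord.
have -> : INR (ksum k l) * (ln (INR (dsum alpha beta l)) - ln (INR (ksum k l))) =
    (\sum_(i < l) INR (k i.+1) * (ln (INR (dsum alpha beta l)) - ln (INR (ksum k l))))%R.
  by rewrite [X in X * _]INR_ksum; apply: mulr_suml.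
rewrite RmultE RdivE RplusE RminusE -sumrB -big_split /= mulr_sumr mulr_suml.
apply: eq_bigr => i _.
have ki := INR_gt0 (k0 i); have di := INR_gt0 (d0 i).
rewrite /log2 !ln_div //; try by apply: Rdiv_lt_0_compat.
rewrite !(RdivE, RminusE, RmultE).
have K0' : (INR (ksum k l) != 0)%R by apply/eqP; apply: Rgt_not_eq.
have l2' : (ln 2 != 0)%R by apply/eqP.
by field; rewrite K0' l2'.
Qed.

Theorem theorem4p1
  (N l : nat) (q k alpha beta : nat -> nat)
  (tau : forall i j : nat, mpoly.mpoly (k i + q i.-1) R)
  (hN : (1 <= N)%N) (hl : (1 <= l)%N)
  (hq0 : q 0%N = N) (hql : q l = 1%N)
  (hq : forall i, (1 <= i < l)%N -> (1 <= q i)%N)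
  (hk : forall i, (1 <= i <= l)%N -> (2 <= k i)%N)
  (halpha : forall i, (1 <= i <= l)%N -> (1 <= alpha i)%N)
  (hbeta : forall i, (1 <= i <= l)%N -> (1 <= beta i)%N)
  (htau : forall i j, (1 <= i <= l)%N -> (j < q i)%N ->
            split_degree_le (tau i j) (alpha i) (beta i))
  (X : seq 'rV[R]_N) :
  uniq X -> shattered (q := q) tau l X ->
  INR (size X) <= 2 * INR (ksum k l) *
     (log2 (4 * exp 1 * INR (dsum alpha beta l)) - rel_entropy k alpha beta l).
Proof.
move=> uX shX; have count := shattered_count hql halpha hbeta htau uX shX.
have k0 (i : 'I_l) : (0 < k i.+1)%N by apply: ltnW; apply: hk; rewrite ltn_ord.
have d0 (i : 'I_l) := dlayer_gt0 i halpha hbeta.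
pose i0 : 'I_l := Ordinal hl.
have K0 : (0 < ksum k l)%N.
  by rewrite /ksum big_add1 big_mkord (bigD1 i0) // addn_gt0 (k0 i0).
have D0 : (0 < dsum alpha beta l)%N.
  by rewrite /dsum big_add1 big_mkord (bigD1 i0) // addn_gt0 (d0 i0).
have ent := scaled_rel_entropy k0 d0 K0 D0.
set A := (\sum_(i < l) INR (k i.+1) * ln (INR (k i.+1)))%R in ent.
set B := (\sum_(i < l) _)%R in ent.
set m := size X in count *.
have n0 : (0 < m + 3 * ksum k l)%N by lia.
(* Logarithm of the counting inequality, with the factorials replaced by their lower bounds; the
   terms [- k_i] add up to [- k]. *)
have lnc : INR m * ln 2 + (A - INR (ksum k l)) <=
    INR (ksum k l) * ln (INR (m + 3 * ksum k l)) + B.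
  have pk : (0 < \prod_(i < l) (k i.+1)`!)%N by apply: prodn_gt0 => i; apply: fact_gt0.
  have pd : (0 < \prod_(i < l) dlayer alpha beta l i.+1 ^ k i.+1)%N.
    by apply: prodn_gt0 => i; rewrite expn_gt0 d0.
  have p2 : (0 < 2 ^ m)%N by rewrite expn_gt0.
  have pn : (0 < (m + 3 * ksum k l) ^ ksum k l)%N by rewrite expn_gt0 n0.
  have : ln (INR (2 ^ m * \prod_(i < l) (k i.+1)`!)) <=
      ln (INR ((m + 3 * ksum k l) ^ ksum k l *
        \prod_(i < l) dlayer alpha beta l i.+1 ^ k i.+1)).
    apply: ln_le; first by apply: INR_gt0; rewrite muln_gt0 p2.
    exact/le_INR/ssrnat.leP.
  rewrite !INR_mul !ln_mult; try exact: INR_gt0.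
  rewrite !ln_INR_expn // !ln_INR_prod; last 2 first.
  - by move=> i; rewrite expn_gt0 d0.
  - by move=> i; apply: fact_gt0.
  have -> : (\sum_(i < l) ln (INR (dlayer alpha beta l i.+1 ^ k i.+1)))%R = B.
    by apply: eq_bigr => i _; rewrite ln_INR_expn.
  have h : A - INR (ksum k l) <= (\sum_(i < l) ln (INR (k i.+1)`!))%R.
    rewrite INR_ksum /A RminusE -sumrB; apply/RleP; apply: ler_sum => i _.
    exact/RleP/ln_fact_ge.
  have -> : INR 2 = 2 by [].
  Lra.lra.
have Kp := INR_gt0 K0; have Dp := INR_gt0 D0; have ep := exp_pos 1.
have m0 : 0 <= INR m by apply: pos_INR.
have l2 := ln_lt_2.
(* with [t = m / K] this is [ln ((t + 3) / 4) <= t / 4 <= (t / 2) ln 2] *)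
have lnt : INR (ksum k l) * (ln (INR (m + 3 * ksum k l)) - ln 4 - ln (INR (ksum k l)))
    <= INR m / 4.
  have -> : INR (m + 3 * ksum k l) = INR m + 3 * INR (ksum k l).
    by rewrite plus_INR INR_mul (_ : INR 3 = 3) //=; Lra.lra.
  set x := INR (ksum k l) in Kp *.
  have y0 : 0 < (INR m + 3 * x) / (4 * x) by apply: Rdiv_lt_0_compat; Lra.lra.
  have yE : x * ((INR m + 3 * x) / (4 * x)) = (INR m + 3 * x) / 4.
    have e : x * / x = 1 by apply: Rinv_r; Lra.lra.
    rewrite /Rdiv Rinv_mult.
    have -> : x * ((INR m + 3 * x) * (/ 4 * / x)) = (INR m + 3 * x) * / 4 * (x * / x).
      by Lra.lra.
    by rewrite e; Lra.lra.
  (* The tangent bound [ln y <= y - 1] at [y = (m + 3 x) / (4 x)], multiplied by [x], gives the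
     upper bound [(m - x) / 4]. *)
  have := Rmult_le_compat_l x _ _ (Rlt_le _ _ Kp) (ln_le_sub1 y0).
  rewrite ln_div ?ln_mult; try Lra.lra.
have -> : log2 (4 * exp 1 * INR (dsum alpha beta l)) =
    (ln 4 + 1 + ln (INR (dsum alpha beta l))) / ln 2.
  have e4 : 0 < 4 * exp 1 by Lra.lra.
  by rewrite /log2 (ln_mult _ _ e4 Dp) ln_mult ?ln_exp //; Lra.lra.
rewrite Rmult_assoc Rmult_minus_distr_l ent.
set L := ln (INR (dsum alpha beta l)); set LK := ln (INR (ksum k l)) in lnt *.
set Ln := ln (INR (m + _)) in lnt lnc.
(* The logarithm of [d] cancels between [log2 (4 e d)] and the relative entropy. *)
have -> : INR (ksum k l) * ((ln 4 + 1 + L) / ln 2)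
    - (A - B + INR (ksum k l) * (L - LK)) / ln 2
   = (INR (ksum k l) * (ln 4 + 1 + LK) - A + B) / ln 2.
  rewrite /Rdiv; Lra.lra.
apply: (Rmult_le_reg_r (ln 2)); first by Lra.lra.
rewrite /Rdiv Rmult_assoc [_ * / ln 2 * ln 2]Rmult_assoc Rinv_l ?Rmult_1_r; last Lra.lra.
(* From [ln 2 >= 1 / 2], the term [m / 4] is absorbed by half of [m * ln 2]; the remaining half
   accounts for the factor 2 in the bound. *)
have := Rmult_le_compat_l (INR m) (/ 2) (ln 2) m0 ltac:(Lra.lra).
Lra.nra.
Qed.
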